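(* Let $s$ be a uniformly random binary string of length $n$. Then the expected number of closed repeats in $s$ is $\Omega(n\log n)$; i.e., there are constants $c>0$ and $n_0$ such that for all $n\ge n_0$ the expected number of closed repeats in $s$ is at least $c\,n\log n$.
   Context: For a string $s$ of length $n$, $s[i\,..\,j]$ denotes the substring $s[i]\cdots s[j]$. A non-empty substring $s[i\,..\,j]$ is a closed repeat if it has an occurrence $s[i'\,..\,j']=s[i\,..\,j]$ with $i'>i$ such that $s[i\,..\,j]$ does not occur at any of the positions $i+1,\dots,i'-1$, and both (either $j'=n$ or $s[j+1]\ne s[j'+1]$) and (either $i=1$ or $s[i-1]\ne s[i'-1]$) hold. Closed repeats that are equal as strings but occur at different positions are counted as different. Logarithms are base 2. *)

(* Defs.v *)
From mathcomp Require Import all_boot all_order all_algebra.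
From mathcomp Require Import reals exp.

Set Implicit Arguments.
Unset Strict Implicit.
Unset Printing Implicit Defensive.

Import GRing.Theory Num.Theory.

(* Positions in strings are counted from 0, and the interval [i .. j] includes
   both endpoints. *)
Definition substring (s : seq bool) (i j : nat) : seq bool :=
  take (j.+1 - i) (drop i s).

Definition occurs_at (u s : seq bool) (k : nat) : bool := prefix u (drop k s).

(* Two occurrences may overlap. In an n-tuple the first position is 0 and the
   last one is n - 1, so the maximality conditions read j' + 1 = n or
   s[j + 1] != s[j' + 1], and i = 0 or s[i - 1] != s[i' - 1]; the default value
   of nth and the truncation in .-1 are harmless, since j < j' and i < i'. *)
Definition closed_repeat (n : nat) (s : n.-tuple bool) (i j : 'I_n) : bool :=
  (i <= j) &&
  [exists i' : 'I_n,
    let u := substring s i j in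
    let j' := i' + (j - i) in
    [&& i < i',
        occurs_at u s i',
        [forall k : 'I_n, (i < k < i') ==> ~~ occurs_at u s k],
        (j'.+1 == n) || (nth false s j.+1 != nth false s j'.+1)
      & (i == 0 :> nat) || (nth false s i.-1 != nth false s i'.-1)]].

Definition num_closed_repeats (n : nat) (s : n.-tuple bool) : nat :=
  #|[set ij : 'I_n * 'I_n | closed_repeat s ij.1 ij.2]|.

Local Open Scope ring_scope.

Definition uniform_expectation (R : realType) (T : finType) (X : T -> R) : R :=
  \sum_(t : T) #|T|%:R^-1 * X t.

Definition log2 (R : realType) (x : R) : R := ln x / ln 2.

(* Main.v *)
(* Fix a length l and a position i >= 1, and let p be the next occurrence after i
   of the length-l window at i, with p + l < n. Flipping bit i - 1 or bit p + l of
   the string moves neither p nor the window, but toggles the left, resp. right,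
   maximality condition; hence exactly a quarter of the strings with next
   occurrence p have a closed repeat of length l at i. In every string at most
   2 ^ l of the n - l - 1 admissible positions have no such p, since the
   corresponding windows are distinct. Summing over the l < log n - 1 gives the
   bound. *)

Require Import Defs.
From mathcomp Require Import all_boot all_order all_algebra.
From mathcomp Require Import reals exp.
From mathcomp Require Import zify lra.

Set Implicit Arguments.
Unset Strict Implicit.
Unset Printing Implicit Defensive.

Import Order.TTheory GRing.Theory Num.Theory.

(** * Windows and their next occurrences *)

Definition window (s : seq bool) (l i : nat) : seq bool := take l (drop i s).

Definition next_occ (s : seq bool) (l i p : nat) : bool :=
  [&& i < p, window s l p == window s l i &
      [forall k : 'I_p, (i < k) ==> (window s l k != window s l i)]].

(** The bounds ensure that the bits at [i - 1] and [p + l] exist: both can be flipped, and the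
    boundary alternatives in [closed_repeat] do not arise. *)
Definition inner_next_occ (s : seq bool) (l i p : nat) : bool :=
  [&& 0 < i, p + l < size s & next_occ s l i p].

Definition left_max (s : seq bool) (i p : nat) : bool :=
  nth false s i.-1 != nth false s p.-1.

Definition right_max (s : seq bool) (l i p : nat) : bool :=
  nth false s (i + l) != nth false s (p + l).

(** * Flipping bits outside the windows *)

Definition flip_bit n (k : 'I_n) (s : n.-tuple bool) : n.-tuple bool :=
  [tuple tnth s i (+) (i == k) | i < n].

Lemma nth_flip_bit n (k : 'I_n) (s : n.-tuple bool) m :
  nth false (flip_bit k s) m = nth false s m (+) (m == k).
Proof.
have [mn|nm] := ltnP m n.
  by rewrite -[m]/(nat_of_ord (Ordinal mn)) -!tnth_nth tnth_mktuple.
rewrite !nth_default ?size_tuple //.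
by case: eqP nm => // ->; rewrite leqNgt ltn_ord.
Qed.

Lemma flip_bitK n (k : 'I_n) : involutive (flip_bit k).
Proof.
move=> s; apply/val_inj/(@eq_from_nth _ false) => [|m _]; rewrite ?size_tuple //.
by rewrite !nth_flip_bit addbK.
Qed.

Lemma window_flip_bit n (k : 'I_n) (s : n.-tuple bool) l i :
  (k < i) || (i + l <= k) -> window (flip_bit k s) l i = window s l i.
Proof.
move=> ki; apply: (@eq_from_nth _ false) => [|m].
  by rewrite !size_take !size_drop !size_tuple.
rewrite size_take_min leq_min => /andP[ml _].
rewrite !nth_take // !nth_drop nth_flip_bit.
by rewrite (_ : (i + m == k) = false) ?addbF //; lia.
Qed.

(** All the windows compared start between [i] and [p], so they read only bits from [i] to
    [p + l - 1]. *)
Lemma next_occ_flip_bit n (k : 'I_n) (s : n.-tuple bool) l i p :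
  (k < i) || (p + l <= k) -> next_occ (flip_bit k s) l i p = next_occ s l i p.
Proof.
move=> kip; rewrite /next_occ; case: ltnP => //= ip.
rewrite !window_flip_bit; [|lia..]; congr (_ && _).
apply: eq_forallb => q; case: ltnP => //= iq.
by rewrite window_flip_bit //; have := ltn_ord q; lia.
Qed.

(** [h] swaps the elements of [A] that satisfy [C] with those that do not. *)
Lemma card_toggle (T : finType) (h : T -> T) (A C : pred T) :
    involutive h -> (forall x, A (h x) = A x) ->
    (forall x, A x -> C (h x) = ~~ C x) ->
  #|A| = #|[pred x | A x && C x]|.*2.
Proof.
move=> hK Ah Ch; rewrite -addnn -(cardID C A).
congr (_ + _).
rewrite -(card_image (can_inj hK) [pred x | A x && C x]).
apply: eq_card => x; rewrite -[x in RHS]hK (mem_image (can_inj hK)).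
by rewrite !inE Ah andbC !unfold_in; case: (boolP (A x)) => //= /Ch ->.
Qed.

Lemma card_inner_next_occ n l i p :
  #|[pred s : n.-tuple bool | inner_next_occ s l i p]| =
  4 * #|[pred s : n.-tuple bool |
         [&& inner_next_occ s l i p, left_max s i p & right_max s l i p]]|.
Proof.
(* Outside these bounds both sides are zero. *)
have [/and3P[i0 ip pn]|H] := boolP [&& 0 < i, i < p & p + l < n]; last first.
  have A0 (s : n.-tuple bool) : inner_next_occ s l i p = false.
    by apply: contraNF H => /and3P[-> + /and3P[-> _ _]]; rewrite size_tuple.
  by rewrite !eq_card0 // => s; rewrite !inE /= A0.
have i1n : i.-1 < n by lia.
pose a := Ordinal i1n; pose b := Ordinal pn.
have occ_flip (k : 'I_n) : (k < i) || (p + l <= k) -> forall s : n.-tuple bool,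
    inner_next_occ (flip_bit k s) l i p = inner_next_occ s l i p.
  by move=> kip s; rewrite /inner_next_occ next_occ_flip_bit // !size_tuple.
rewrite (@card_toggle _ (flip_bit a) _ (fun s => left_max s i p)); first last.
- move=> s _; rewrite /left_max !nth_flip_bit /= eqxx.
  by rewrite (_ : (p.-1 == i.-1) = false); [case: nth; case: nth|lia].
- by move=> s; rewrite /= occ_flip //=; lia.
- exact: flip_bitK.
(* The second halving takes place among the strings with [left_max]; flipping bit [p + l] preserves
   that condition, as it touches neither [i - 1] nor [p - 1]. *)
rewrite (@card_toggle _ (flip_bit b) _ (fun s => right_max s l i p)); first last.
- move=> s _; rewrite /right_max !nth_flip_bit /= eqxx.
  by rewrite (_ : (i + l == p + l) = false); [case: nth; case: nth|lia].
- move=> s; rewrite /= occ_flip ?leqnn ?orbT //; congr (_ && _).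
  rewrite /left_max !nth_flip_bit /=.
  have [-> ->] : (i.-1 == p + l) = false /\ (p.-1 == p + l) = false by lia.
  by rewrite !addbF.
- exact: flip_bitK.
rewrite -!muln2 -mulnA mulnC; congr (_ * _).
by apply: eq_card => s; rewrite !inE /= andbA.
Qed.

(** * Counting recurring windows in one string *)

Lemma next_occ_inj s l i p q : next_occ s l i p -> next_occ s l i q -> p = q.
Proof.
move=> /and3P[ip Ep /forallP Np] /and3P[iq Eq /forallP Nq].
have [pq|qp|//] := ltngtP p q.
  by have := Nq (Ordinal pq); rewrite /= ip Ep.
by have := Np (Ordinal qp); rewrite /= iq Eq.
Qed.

Lemma next_occ_exists s l i p :
  i < p -> window s l p = window s l i -> exists2 q, q <= p & next_occ s l i q.
Proof.
move=> ip Ep.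
have ex : exists q, (i < q) && (window s l q == window s l i).
  by exists p; rewrite ip Ep eqxx.
case: (ex_minnP ex) => q /andP[iq Eq] qmin.
exists q; first by apply: qmin; rewrite ip Ep eqxx.
apply/and3P; split=> //; apply/forallP => k; apply/implyP => ik.
by apply/negP => Ek; have := qmin k; rewrite ik Ek leqNgt ltn_ord => /(_ isT).
Qed.

Lemma size_window s l i : i + l <= size s -> size (window s l i) = l.
Proof. by move=> H; rewrite size_takel // size_drop; lia. Qed.

Lemma card_inner_next_occ_ge n (s : n.-tuple bool) l :
  n - l.+1 - 2 ^ l <=
    #|[set ip : 'I_n * 'I_n | inner_next_occ s l ip.1 ip.2]|.
Proof.
pose P := [set ip : 'I_n * 'I_n | inner_next_occ s l ip.1 ip.2].
(* Every position of [I] outside [D] is the first component of a pair in [P], so [#|P|] is at least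
   [#|I| - #|D|]. *)
pose I := [set i : 'I_n | 0 < i < n - l].
pose D := I :\: [set ip.1 | ip in P].
have cardI : n - l.+1 <= #|I|.
  case: n s {P D} @I => // n s I.
  pose f (k : 'I_(n.+1 - l.+1)) : 'I_n.+1 := inord k.+1.
  have fE k : f k = k.+1 :> nat by rewrite inordK //; have := ltn_ord k; lia.
  have f_inj : injective f.
    by move=> x y /(congr1 val); rewrite /= !fE => -[/val_inj].
  rewrite -[leqLHS]card_ord -(card_imset predT f_inj); apply: subset_leq_card.
  apply/subsetP => _ /imsetP[k _ ->]; rewrite inE fE.
  by have := ltn_ord k; lia.
have cardD : #|D| <= 2 ^ l.
  (* The default tuple is never taken on [I], where windows have full length [l]. *)
  pose w (i : 'I_n) : l.-tuple bool := insubd [tuple of nseq l false] (window s l i).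
  have wE (i : 'I_n) : i \in I -> w i = window s l i :> seq bool.
    rewrite inE => iI; rewrite val_insubd size_window ?eqxx // size_tuple; lia.
  (* An equal window at [j] yields a next occurrence [q <= j]; it is inner because [j + l < n],
     which contradicts [i \in D]. *)
  have noD (i j : 'I_n) : i \in D -> j \in I -> i < j ->
      window s l j <> window s l i.
    rewrite inE => /andP[/imsetP iP iI] jI ij Ew; apply: iP.
    have [q qj qn] := next_occ_exists ij Ew.
    have qltn : q < n by have := ltn_ord j; lia.
    exists (i, Ordinal qltn) => //; rewrite inE /inner_next_occ /= qn size_tuple.
    by move: iI jI; rewrite !inE; lia.
  have w_inj : {in D &, injective w}.
    move=> i j Di Dj /(congr1 val) /=.
    have [Ii Ij] : i \in I /\ j \in I 
    by move: Di Dj; rewrite !inE => /andP[_ ->] /andP[_ ->].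
    rewrite !wE // => Ew; apply: val_inj => /=.
    have [ij|ji|//] := ltngtP i j; first by case: (noD i j Di Ij ij).
    by case: (noD j i Dj Ii ji).
  rewrite -card_bool -card_tuple -(card_in_imset w_inj); exact: max_card.
have := cardsD I [set ip.1 | ip in P]; rewrite -/D => DE.
have : #|I :&: [set ip.1 | ip in P]| <= #|P|.
  exact: leq_trans (subset_leq_card (subsetIr _ _)) (leq_imset_card _ _).
rewrite -/P; lia.
Qed.

(** * From next occurrences to closed repeats *)

Lemma closed_repeat_of_next_occ n (s : n.-tuple bool) (i j p : 'I_n) l :
    j = i + l :> nat -> inner_next_occ s l.+1 i p ->
    left_max s i p -> right_max s l.+1 i p ->
  closed_repeat s i j.
Proof.
move=> jE /and3P[i0 pn /and3P[ip Ep /forallP Np]] Lm Rm.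
rewrite size_tuple in pn.
have uE : substring s i (i + l) = window s l.+1 i.
  by rewrite /substring (_ : (i + l).+1 - i = l.+1) //; lia.
(* Both ends are included, so the substring has exactly [l.+1] letters, and being a prefix at [k]
   amounts to equality of windows of that length. *)
have occE k : occurs_at (substring s i (i + l)) s k =
      (window s l.+1 k == window s l.+1 i).
  by rewrite /occurs_at uE prefixE size_window ?size_tuple //; lia.
rewrite /closed_repeat jE leq_addr /=; apply/existsP; exists p => /=.
rewrite ip occE Ep addKn /=; apply/and3P; split.
- apply/forallP => k; rewrite occE; apply/implyP => /andP[ik kp].
  by have := Np (Ordinal kp); rewrite /= ik.
- by rewrite -!addnS; apply/orP; right.
- by apply/orP; right.
Qed.

(** The triple [(l, (i, p))] is sent to the closed repeat with ends [i] and [i + l], of length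
    [l.+1]. The ends determine [l], and then [p] is determined as the next occurrence. *)
Lemma num_closed_repeats_ge n (s : n.-tuple bool) L :
  #|[set t : 'I_L * ('I_n * 'I_n) |
      [&& inner_next_occ s t.1.+1 t.2.1 t.2.2, left_max s t.2.1 t.2.2
        & right_max s t.1.+1 t.2.1 t.2.2]]| <= num_closed_repeats s.
Proof.
case: n s => [|n] s; first by rewrite eq_card0 // => -[? [[]]].
pose f (t : 'I_L * ('I_n.+1 * 'I_n.+1)) : 'I_n.+1 * 'I_n.+1 :=
  (t.2.1, inord (t.2.1 + t.1)).
set S := [set t | _].
have fE (t : 'I_L * ('I_n.+1 * 'I_n.+1)) : t \in S -> (f t).2 = t.2.1 + t.1 :> nat.
  rewrite inE => /and3P[/and3P[_]]; rewrite size_tuple => H /and3P[H2 _ _] _ _.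
  by rewrite inordK //; lia.
have f_inj : {in S &, injective f}.
  move=> t t' St St' Ef; have := fE t St; rewrite Ef (fE t' St').
  have {Ef} : t.2.1 = t'.2.1 := congr1 fst Ef.
  move: t t' St St' => [l [i p]] [l' [i' p']] /= St St' Ei El.
  have {El} ll' : l' = l by apply: val_inj => /=; rewrite Ei in El; lia.
  rewrite ll' -Ei in St' *; congr (_, (_, _)); apply: val_inj => /=.
  move: St St'; rewrite !inE /=.
  move=> /and3P[/and3P[_ _ N] _ _] /and3P[/and3P[_ _ N'] _ _].
  exact: next_occ_inj N N'.
rewrite -(card_in_imset f_inj); apply: subset_leq_card.
apply/subsetP => _ /imsetP[t St ->]; rewrite inE.
have jE := fE t St; move: St; rewrite inE => /and3P[H1 H2 H3].
exact: closed_repeat_of_next_occ jE H1 H2 H3.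
Qed.

(** * Summation over strings and lengths *)

Lemma sum_num_closed_repeats_ge n L :
  2 ^ n * \sum_(l < L) (n - l.+2 - 2 ^ l.+1) <=
  4 * \sum_(s : n.-tuple bool) num_closed_repeats s.
Proof.
pose A (s : n.-tuple bool) (t : 'I_L * ('I_n * 'I_n)) :=
  inner_next_occ s t.1.+1 t.2.1 t.2.2.
pose B (s : n.-tuple bool) (t : 'I_L * ('I_n * 'I_n)) :=
  [&& A s t, left_max s t.2.1 t.2.2 & right_max s t.1.+1 t.2.1 t.2.2].
apply: (@leq_trans (\sum_(s : n.-tuple bool) \sum_t A s t)).
  rewrite -[in X in X * _]card_bool -card_tuple -sum_nat_const; apply: leq_sum => s _.
  rewrite -(pair_big xpredT xpredT (fun l ip => nat_of_bool (A s (l, ip)))) /=.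
  apply: leq_sum => l _; apply: leq_trans (card_inner_next_occ_ge s l.+1) _.
  rewrite -sum1_card big_mkcond /=; apply: leq_sum => ip _.
  by rewrite inE /A /=; case: inner_next_occ.
apply: (@leq_trans (4 * \sum_(s : n.-tuple bool) \sum_t B s t)); last first.
  rewrite leq_mul2l /=; apply: leq_sum => s _.
  apply: leq_trans (num_closed_repeats_ge s L).
  rewrite -sum1_card [leqRHS]big_mkcond /=; apply: leq_sum => t _.
  by rewrite inE -/(A s t) -/(B s t); case: (B s t).
(* With the triple fixed and the string varying, the comparison is the factor 4 of
   [card_inner_next_occ]. *)
rewrite exchange_big [in leqRHS]exchange_big /= big_distrr /=.
apply: leq_sum => t _.
have E (C : pred (n.-tuple bool)) : \sum_s (C s : nat) = #|[pred s | C s]|.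
  rewrite -sum1_card [RHS]big_mkcond /=; apply: eq_bigr => s _.
  by rewrite inE; case: (C s).
by rewrite !E card_inner_next_occ.
Qed.

(** Both [l.+2] and [2 ^ l.+1] are at most [2 ^ L], hence at most [n / 4], so each of the [L]
    summands is at least [n / 2]. *)
Lemma sum_window_bound n L :
  2 ^ L.+2 <= n -> n * L <= 2 * \sum_(l < L) (n - l.+2 - 2 ^ l.+1).
Proof.
move=> Ln; rewrite big_distrr /= mulnC -[L in L * _]card_ord -sum_nat_const.
apply: leq_sum => l _.
have : 2 ^ l.+1 <= 2 ^ L by rewrite leq_exp2l // ltn_ord.
have : l.+1 < 2 ^ l.+1 by exact: ltn_expl.
move: Ln; rewrite !(expnS 2 L.+1) (expnS 2 L).
move: (2 ^ l.+1) (2 ^ L) => x y; lia.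
Qed.

Local Open Scope ring_scope.

Lemma log2_le_trunc_log (R : realType) n :
  (0 < n)%N -> log2 (n%:R : R) <= (trunc_log 2 n).+1%:R.
Proof.
move=> n0; have ln2 : 0 < ln 2 :> R by rewrite ln_gt0 // ltr1n.
rewrite /log2 ler_pdivrMr // mulr_natl -lnXn // ler_ln ?posrE ?ltr0n ?exprn_gt0 //.
by rewrite -natrX ler_nat ltnW // trunc_log_ltn.
Qed.

Theorem theorem2 (R : realType) :
  exists (c : R) (n0 : nat),
    0 < c /\
    forall n : nat, (n0 <= n)%N ->
      c * (n%:R * log2 (n%:R : R)) <=
      uniform_expectation
        (fun s : n.-tuple bool => (num_closed_repeats s)%:R).
Proof.
(* The 16 is 4 from the two maximality conditions, 2 from [sum_window_bound], and 2 from bounding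
   [log2 n] by [2 * (t - 2)]. The last bound needs [t + 1 <= 2 * (t - 2)], that is [t >= 5], whence
   32. *)
exists 16%:R^-1, 32; split=> [|n n32]; first by rewrite invr_gt0 ltr0n.
set t := trunc_log 2 n.
have t5 : (5 <= t)%N by exact: trunc_log_max.
have tn : (2 ^ t <= n)%N by rewrite trunc_logP //; lia.
have logn : log2 (n%:R : R) <= (2 * t.-2)%:R.
  apply: le_trans (log2_le_trunc_log R _) _; first by lia.
  by rewrite ler_nat -/t; lia.
rewrite /uniform_expectation -mulr_sumr card_tuple card_bool -natr_sum.
(* Taking [t - 2] lengths turns the hypothesis of [sum_window_bound] into [2 ^ t <= n]. *)
have tE : t.-2.+2 = t by lia.
have Hw : (n * t.-2 <= 2 * \sum_(l < t.-2) (n - l.+2 - 2 ^ l.+1))%N.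
  by apply: sum_window_bound; rewrite tE.
have Hs := sum_num_closed_repeats_ge n t.-2.
rewrite ler_pdivlMl ?ltr0n ?expn_gt0 //.
set S := (\sum_(s : n.-tuple bool) _)%N in Hs *.
have H : (2 ^ n * (n * t.-2) <= 8 * S)%N.
  apply: leq_trans (leq_mul (leqnn (2 ^ n)%N) Hw) _; rewrite mulnCA.
  by rewrite (_ : 8 = 2 * 4)%N // -mulnA leq_mul2l.
have n0 : (0 : R) <= n%:R by [].
have e0 : (0 : R) <= (2 ^ n)%:R by [].
have := ler_wpM2l e0 (ler_wpM2l n0 logn).
have : ((2 ^ n * (n * t.-2))%:R : R) <= (8 * S)%:R by rewrite ler_nat.
rewrite !natrM; lra.
Qed.
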